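(* Let $Q$ be a strong commutative semicartesian quantale. For every $Q$-set $X$, the $Q$-set of singletons $\mathfrak{S}(X)$ is Scott-complete.
   Context: A quantale is a complete lattice $(Q,\le)$ with an associative binary operation $\otimes$ that distributes over arbitrary suprema in each variable. It is commutative if $\otimes$ is commutative; semicartesian if $a\otimes b\le a\wedge b$ for all $a,b$; strong if for every $e\in Q$ with $e=e\otimes e$ and every $A\subseteq Q$, $e\le\bigvee_{a\in A}a$ implies $e\le\bigvee_{a\in A}a\otimes a$. A $Q$-set is a set $X$ with a map $\delta:X\times X\to Q$ such that for all $x,y,z$: $\delta(x,y)=\delta(y,x)$; $\delta(x,y)\otimes\delta(y,z)\le\delta(x,z)$; $\delta(x,x)\otimes\delta(x,y)=\delta(x,y)$. The extent of $x$ is $Ex:=\delta(x,x)$. A singleton on $X$ is a map $\sigma:X\to Q$ such that for all $x,y\in X$: $\sigma(x)\otimes Ex=\sigma(x)$; $\sigma(x)\otimes\delta(x,y)\le\sigma(y)$; $\sigma(x)\otimes\sigma(y)\le\delta(x,y)$; $\sigma(x)\otimes\bigvee_{y\in X}\sigma(y)=\sigma(x)$. An element $x_\sigma\in X$ represents $\sigma$ if $\sigma(y)=\delta(y,x_\sigma)$ for all $y\in X$. $X$ is Scott-complete if every singleton on $X$ has exactly one representing element. $\mathfrak{S}(X)$ is the set of singletons on $X$ with $\delta(\sigma,\xi)=\bigvee_{x\in X}\sigma(x)\otimes\xi(x)$; for strong $Q$ this is a $Q$-set. *)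

(* Defs.v *)
From HB Require Import structures.
From mathcomp Require Import all_boot all_order.
From mathcomp Require Import boolp classical_sets.

Set Implicit Arguments.
Unset Strict Implicit.
Unset Printing Implicit Defensive.

Import Order.TTheory.
Local Open Scope classical_set_scope.
Local Open Scope order_scope.

Declare Scope quantale_scope.
Delimit Scope quantale_scope with Qt.
Local Open Scope quantale_scope.

(* Suprema of all subsets suffice for completeness: the infimum of A is the
   supremum of its lower bounds, and \bot is the supremum of set0. *)
HB.mixin Record hasSuprema d T of Order.Lattice d T := {
  qsup : set T -> T;
  qsup_isLub : forall A : set T, isLub A (qsup A)
}.

#[short(type="completeLatticeType")]
HB.structure Definition CompleteLattice d :=
  {T of hasSuprema d T & Order.Lattice d T}.

HB.mixin Record isQuantale d T of CompleteLattice d T := {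
  tensor : T -> T -> T;
  tensorA : associative tensor;
  tensor_qsupr : forall (a : T) (B : set T),
    tensor a (qsup B) = qsup [set tensor a b | b in B];
  tensor_qsupl : forall (A : set T) (b : T),
    tensor (qsup A) b = qsup [set tensor a b | a in A]
}.

#[short(type="quantaleType")]
HB.structure Definition Quantale d :=
  {T of isQuantale d T & CompleteLattice d T}.

Notation "a ⊗ b" := (tensor a b) (at level 40, left associativity)
  : quantale_scope.

Definition commutative_quantale d (Q : quantaleType d) : Prop :=
  forall a b : Q, a ⊗ b = b ⊗ a.

Definition semicartesian d (Q : quantaleType d) : Prop :=
  forall a b : Q, a ⊗ b <= a `&` b.

Definition strong d (Q : quantaleType d) : Prop :=
  forall (e : Q) (A : set Q), e = e ⊗ e ->
    e <= qsup A -> e <= qsup [set a ⊗ a | a in A].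

Record qset d (Q : quantaleType d) := QSet {
  qcarrier :> Type;
  delta : qcarrier -> qcarrier -> Q;
  delta_sym : forall x y, delta x y = delta y x;
  delta_trans : forall x y z, delta x y ⊗ delta y z <= delta x z;
  delta_extent : forall x y, delta x x ⊗ delta x y = delta x y
}.
Arguments delta {d Q q} x y.

Definition extent d (Q : quantaleType d) (X : qset Q) (x : X) : Q := delta x x.

Record is_singleton d (Q : quantaleType d) (X : qset Q) (s : X -> Q) : Prop :=
  IsSingleton {
    singleton_extent : forall x, s x ⊗ extent x = s x;
    singleton_delta : forall x y, s x ⊗ delta x y <= s y;
    singleton_le_delta : forall x y, s x ⊗ s y <= delta x y;
    singleton_qsup : forall x, s x ⊗ qsup (range s) = s x
  }.

Definition represents d (Q : quantaleType d) (X : qset Q) (x : X) (s : X -> Q) :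
  Prop := forall y, s y = delta y x.

Definition scott_complete d (Q : quantaleType d) (X : qset Q) : Prop :=
  forall s : X -> Q, is_singleton s -> exists! x : X, represents x s.

Record singleton d (Q : quantaleType d) (X : qset Q) := Singleton {
  singleton_fun :> X -> Q;
  singletonP : is_singleton singleton_fun
}.

Definition singleton_delta_fun d (Q : quantaleType d) (X : qset Q)
  (s t : singleton X) : Q := qsup (range (fun x => s x ⊗ t x)).

Section SingletonsQSet.
Context d (Q : quantaleType d).

Lemma qsup_ub (A : set Q) a : A a -> a <= qsup A.
Proof. by case: (qsup_isLub A) => h _; exact: h. Qed.

Lemma qsup_le (A : set Q) b : (forall a, A a -> a <= b) -> qsup A <= b.
Proof. by case: (qsup_isLub A) => _ h hb; exact: h. Qed.

Lemma tensor_le2l (a b c : Q) : b <= c -> a ⊗ b <= a ⊗ c.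
Proof.
move=> bc; have -> : c = qsup [set b; c].
  apply/le_anti/andP; split; first by apply: qsup_ub; right.
  by apply: qsup_le => x [->|->].
by rewrite tensor_qsupr; apply: qsup_ub; exists b => //; left.
Qed.

Lemma tensor_le2r (a b c : Q) : b <= c -> b ⊗ a <= c ⊗ a.
Proof.
move=> bc; have -> : c = qsup [set b; c].
  apply/le_anti/andP; split; first by apply: qsup_ub; right.
  by apply: qsup_le => x [->|->].
by rewrite tensor_qsupl; apply: qsup_ub; exists b => //; left.
Qed.

Hypotheses (Qstrong : strong Q) (Qcomm : commutative_quantale Q)
  (Qsemi : semicartesian Q).
Variable X : qset Q.
Implicit Types s t u : singleton X.

Lemma singleton_delta_sym s t :
  singleton_delta_fun s t = singleton_delta_fun t s.
Proof.
rewrite /singleton_delta_fun.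
have -> // : (fun x => s x ⊗ t x) = (fun x => t x ⊗ s x).
by apply/funext => x; exact: Qcomm.
Qed.

Lemma singleton_delta_trans s t u :
  singleton_delta_fun s t ⊗ singleton_delta_fun t u <= singleton_delta_fun s u.
Proof.
rewrite /singleton_delta_fun tensor_qsupl; apply: qsup_le => _ [_ [x _ <-] <-].
rewrite tensor_qsupr; apply: qsup_le => _ [_ [y _ <-] <-].
have : s y ⊗ u y <= qsup (range (fun x => s x ⊗ u x)).
  by apply: qsup_ub; exists y.
apply: le_trans; rewrite tensorA; apply: tensor_le2r.
apply: (le_trans _ (singleton_delta (singletonP s) x y)).
rewrite -tensorA; apply: tensor_le2l.
exact: singleton_le_delta (singletonP t) x y.
Qed.

Lemma singleton_delta_extent s t :
  singleton_delta_fun s s ⊗ singleton_delta_fun s t = singleton_delta_fun s t.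
Proof.
pose e := qsup (range s).
have ee : e = e ⊗ e.
  rewrite {2}/e tensor_qsupl; congr qsup; apply/seteqP; split => [_ [x _ <-]|].
    by exists (s x); [exists x | exact: singleton_qsup (singletonP s) x].
  by move=> _ [_ [x _ <-] <-]; exists x => //;
    rewrite (singleton_qsup (singletonP s)).
have -> : singleton_delta_fun s s = e.
  apply/le_anti/andP; split.
    apply: qsup_le => _ [x _ <-].
    apply: (le_trans (Qsemi _ _)); apply: (le_trans (leIl _ _)).
    by apply: qsup_ub; exists x.
  have /le_trans := Qstrong ee (lexx e); apply.
  apply: qsup_le => _ [_ [x _ <-] <-].
  by apply: qsup_ub; exists x.
rewrite /singleton_delta_fun tensor_qsupr; congr qsup.
have eq x : e ⊗ (s x ⊗ t x) = s x ⊗ t x.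
  by rewrite tensorA (Qcomm e) (singleton_qsup (singletonP s)).
apply/seteqP; split => [_ [_ [x _ <-] <-]|_ [x _ <-]].
  by exists x => //; rewrite eq.
by exists (s x ⊗ t x); [exists x | rewrite eq].
Qed.

Definition singletons : qset Q :=
  QSet singleton_delta_sym singleton_delta_trans singleton_delta_extent.

End SingletonsQSet.

(* Main.v *)
Require Import Defs.
From mathcomp Require Import all_boot all_order.
From mathcomp Require Import boolp classical_sets.

(** A singleton [F] on the Q-set of singletons is a weighted family of
    singletons on [X]; the point representing it is its weighted union
    [glue F], that is x |-> sup_s F(s) ⊗ s(x).

    Exchanging suprema turns delta(t, glue F) into sup_s F(s) ⊗ delta(s, t).
    Every term is at most F(t) because F is compatible with delta, and the term
    s = t is F(t) itself by the extent axiom, so [glue F] represents F.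

    That [glue F] is a singleton needs two facts. First,
    s(x) ⊗ delta(s, t) ⊗ t(y) <= delta(x, y) ([singletons_link]), which together
    with F(s) ⊗ F(t) <= delta(s, t) gives the third axiom. Second, the extent
    delta(s, s) is the supremum of the values of s ([extent_singletons]); this
    is where strength of Q enters. It makes the supremum of [glue F] equal to
    that of F, so the fourth axiom passes from F to [glue F].

    Uniqueness is a separation property: a singleton t absorbs its extent and
    satisfies t(x) ⊗ delta(t, u) <= u(x), so t <= u pointwise as soon as
    delta(t, t) = delta(t, u) ([singleton_le_of_delta]). *)

Set Implicit Arguments.
Unset Strict Implicit.
Unset Printing Implicit Defensive.

Import Order.TTheory.
Local Open Scope classical_set_scope.
Local Open Scope order_scope.
Local Open Scope quantale_scope.

(** * Suprema of families in a quantale *)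

Section Families.
Context d (Q : quantaleType d).

Lemma qsup_range_ub (I : Type) (f : I -> Q) i : f i <= qsup (range f).
Proof. by apply: qsup_ub; exists i. Qed.

Lemma qsup_range_le (I : Type) (f : I -> Q) b :
  (forall i, f i <= b) -> qsup (range f) <= b.
Proof. by move=> fb; apply: qsup_le => _ [i _ <-]. Qed.

Lemma eq_qsup_range (I : Type) (f g : I -> Q) :
  f =1 g -> qsup (range f) = qsup (range g).
Proof. by move=> /funext ->. Qed.

Lemma tensor_qsup_ranger (I : Type) (a : Q) (f : I -> Q) :
  a ⊗ qsup (range f) = qsup (range (fun i => a ⊗ f i)).
Proof. by rewrite tensor_qsupr image_comp. Qed.

Lemma tensor_qsup_rangel (I : Type) (f : I -> Q) (b : Q) :
  qsup (range f) ⊗ b = qsup (range (fun i => f i ⊗ b)).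
Proof. by rewrite tensor_qsupl image_comp. Qed.

Lemma exchange_qsup (I J : Type) (f : I -> J -> Q) :
  qsup (range (fun i => qsup (range (f i)))) =
  qsup (range (fun j => qsup (range (f ^~ j)))).
Proof.
apply/le_anti/andP; split; apply: qsup_range_le => k; apply: qsup_range_le => l.
  exact: le_trans (qsup_range_ub (f ^~ l) k) (qsup_range_ub _ l).
exact: le_trans (qsup_range_ub (f l) k) (qsup_range_ub _ l).
Qed.

End Families.

Section SingletonsComplete.
Context d (Q : quantaleType d).
Hypotheses (Qstrong : strong Q) (Qcomm : commutative_quantale Q)
  (Qsemi : semicartesian Q).
Variable X : qset Q.
Local Notation SX := (singletons Qstrong Qcomm Qsemi X).
Implicit Types (s t u : singleton X).

(** * Separation of singletons by their distances *)

(** Although [singleton_delta_fun s s] is a supremum of squares s(x) ⊗ s(x),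
    the squares can be dropped: the fourth axiom makes the supremum of the s(x)
    idempotent, so strength applies to it. *)
Lemma extent_singletons s : singleton_delta_fun s s = qsup (range s).
Proof.
have sup_idem : qsup (range s) = qsup (range s) ⊗ qsup (range s).
  rewrite tensor_qsup_rangel; apply: eq_qsup_range => x.
  by rewrite (singleton_qsup (singletonP s)).
apply/le_anti/andP; split.
  apply: qsup_range_le => x; apply: le_trans (qsup_range_ub s x).
  exact: le_trans (Qsemi _ _) (leIl _ _).
by rewrite {1}(_ : singleton_delta_fun s s = qsup [set a ⊗ a | a in range s]);
  [exact: Qstrong | rewrite image_comp].
Qed.

(** The term of the distance at y is s(y) ⊗ t(y), and s(x) ⊗ s(y) <= delta(x, y)
    carries t(y) back to x. *)
Lemma singleton_tensor_delta s t x : s x ⊗ singleton_delta_fun s t <= t x.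
Proof.
rewrite tensor_qsup_ranger; apply: qsup_range_le => y; rewrite tensorA.
apply: le_trans (singleton_delta (singletonP t) y x).
rewrite Qcomm; apply: tensor_le2l; rewrite delta_sym.
exact: singleton_le_delta (singletonP s) x y.
Qed.

Lemma singleton_le_of_delta s t :
  singleton_delta_fun s s = singleton_delta_fun s t -> forall x, s x <= t x.
Proof.
move=> est x; rewrite -(singleton_qsup (singletonP s)) -extent_singletons est.
exact: singleton_tensor_delta.
Qed.

Lemma singleton_ext s t : (forall x, s x = t x) -> s = t.
Proof.
case: s t => [f pf] [g pg] /= /funext efg.
by case: _ / efg pg => pg; rewrite (Prop_irrelevance pf pg).
Qed.

Lemma singletons_link s t x y :
  s x ⊗ singleton_delta_fun s t ⊗ t y <= delta x y.
Proof.
apply: le_trans (singleton_le_delta (singletonP t) x y).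
exact/tensor_le2r/singleton_tensor_delta.
Qed.

(** * The weighted union of a singleton of singletons *)

Definition glue (F : SX -> Q) (x : X) : Q :=
  qsup (range (fun s : singleton X => F s ⊗ s x)).

Lemma qsup_glue (F : SX -> Q) :
  is_singleton F -> qsup (range (glue F)) = qsup (range F).
Proof.
move=> FP; rewrite exchange_qsup; apply: eq_qsup_range => s.
by rewrite -tensor_qsup_ranger -extent_singletons; exact: singleton_extent FP s.
Qed.

Lemma glue_is_singleton (F : SX -> Q) : is_singleton F -> is_singleton (glue F).
Proof.
move=> FP; split=> [x|x y|x y|x].
- rewrite tensor_qsup_rangel; apply: eq_qsup_range => s.
  by rewrite -tensorA (singleton_extent (singletonP s)).
- rewrite tensor_qsup_rangel; apply: qsup_range_le => s.
  apply: le_trans (qsup_range_ub _ s); rewrite -tensorA; apply: tensor_le2l.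
  exact: singleton_delta (singletonP s) x y.
- rewrite tensor_qsup_rangel; apply: qsup_range_le => s.
  rewrite tensor_qsup_ranger; apply: qsup_range_le => t.
  apply: le_trans (singletons_link s t x y).
  rewrite (Qcomm (F s)) tensorA; apply: tensor_le2r; rewrite -tensorA.
  by apply: tensor_le2l; exact: singleton_le_delta FP s t.
- rewrite qsup_glue // tensor_qsup_rangel; apply: eq_qsup_range => s.
  by rewrite -tensorA (Qcomm (s x)) tensorA (singleton_qsup FP).
Qed.

Definition glued (F : SX -> Q) (FP : is_singleton F) : SX :=
  Singleton (glue_is_singleton FP).

Lemma glued_represents (F : SX -> Q) (FP : is_singleton F) :
  represents (glued FP) F.
Proof.
move=> t; have -> : delta t (glued FP) =
    qsup (range (fun s : SX => F s ⊗ delta s t)).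
  rewrite /delta /= /singleton_delta_fun /=.
  under eq_qsup_range => x do rewrite tensor_qsup_ranger.
  rewrite exchange_qsup; apply: eq_qsup_range => s.
  rewrite tensor_qsup_ranger; apply: eq_qsup_range => x.
  by rewrite Qcomm -tensorA.
apply/le_anti/andP; split.
  by rewrite -{1}(singleton_extent FP t); exact: (qsup_range_ub _ t).
by apply: qsup_range_le => s; exact: singleton_delta FP s t.
Qed.

Lemma representing_unique (F : SX -> Q) (s t : SX) :
  represents s F -> represents t F -> s = t.
Proof.
move=> sF tF; have est (u : SX) : delta u s = delta u t by rewrite -sF -tF.
apply: singleton_ext => x; apply/le_anti/andP.
by split; apply: singleton_le_of_delta; [exact: est s | exact/esym/est].
Qed.

End SingletonsComplete.

Theorem mainTheorem3 (d : Order.disp_t) (Q : quantaleType d)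
    (Qstrong : strong Q) (Qcomm : commutative_quantale Q)
    (Qsemi : semicartesian Q) (X : qset Q) :
  scott_complete (singletons Qstrong Qcomm Qsemi X).
Proof.
move=> F FP; exists (glued FP); split; first exact: glued_represents.
by move=> t; exact/representing_unique/glued_represents.
Qed.
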